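(* In the model and with the trapezoidal estimator described in the context, suppose that Assumptions (A), (B), (C), (D) hold, that $f\in C^2([0,1])$, that $f''$ and $g''$ are Lipschitz on $[0,1]$, that for any $t\in[0,1]$ the function $R^{(0,2)}(t,\cdot)$ is Lipschitz on $[0,1]$, that $w$ is a continuous density function, and that $\lim_{n\to\infty}h=0$ and $\lim_{n\to\infty}nh=\infty$. If $\lim_{n\to\infty}nh^2=\infty$ and $\lim_{n,m\to\infty}\frac nm=\infty$, then the optimal sampling density with respect to the asymptotic IMSE, i.e. the solution of $$f^*\in\underset{f>0,\ \int_0^1f(x)dx=1}{\mathrm{argmin}}\ \int_0^1\frac{\alpha(x)}{f^2(x)}w(x)\,dx,$$ is given by $$f^*(t)=\frac{\{\alpha(t)w(t)\}^{1/3}}{\int_0^1\{\alpha(s)w(s)\}^{1/3}\,ds}\,1_{[0,1]}(t).$$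
   Context: Model: $Y_j(t_i)=g(t_i)+\varepsilon_j(t_i)$, $j=1,\dots,m$, $i=1,\dots,n$, where $g\in C^2([0,1])$ is the unknown regression function and $(\varepsilon_j)_j$ are i.i.d. processes on $[0,1]$ distributed as a centered second-order process $\varepsilon$ with autocovariance function $R(s,t)=\mathbb E(\varepsilon(s)\varepsilon(t))$. Put $\overline Y(t)=\frac1m\sum_{j=1}^mY_j(t)$. Design: $f$ is a density on $[0,1]$ with $\inf_{[0,1]}f>0$, $\sup_{[0,1]}f<\infty$ and distribution function $F$; the regular sequence of designs generated by $f$ is $T_n=\{t_{i,n}=F^{-1}(i/n),\ i=1,\dots,n\}$, and observations are taken at $t_i=t_{i,n}$. Estimator: $K$ is a kernel ($\int K=1$) of support $[-1,1]$, $h=h(n,m)$ is a bandwidth with $0<h<1$, $\varphi_{x,h}(t)=\frac1hK\big(\frac{x-t}h\big)$. Let $N_{T_n}$ be the number of points of $T_n$ in $[x-h,x+h]$ and $t_{x,1}<\dots<t_{x,N_{T_n}}$ these points. For $x\in[0,1]$ the trapezoidal estimator is $$\hat g_n^{trap}(x)=\frac1{2n}\sum_{k=1}^{N_{T_n}-1}\Big\{\Big(\frac{\varphi_{x,h}}f\overline Y\Big)(t_{x,k})+\Big(\frac{\varphi_{x,h}}f\overline Y\Big)(t_{x,k+1})\Big\}.$$ Assumptions. (A) $R$ exists and is continuous on $[0,1]^2$. (B) On the diagonal $R$ has continuous left and right first-order derivatives $R^{(0,1)}(t,t^-)=\lim_{s\uparrow t}\frac{\partial R(t,s)}{\partial s}$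 and $R^{(0,1)}(t,t^+)=\lim_{s\downarrow t}\frac{\partial R(t,s)}{\partial s}$; the jump function $\alpha(t)=R^{(0,1)}(t,t^-)-R^{(0,1)}(t,t^+)$ is continuous and not identically equal to zero. (C) Off the diagonal $R$ has continuous mixed partial derivatives $R^{(i,j)}$ up to order two and $\sup_{0\le t\ne s\le1}|R^{(i,j)}(t,s)|<\infty$ for $0\le i+j\le2$. (D) $K$ is even, at least in $C^2([-1,1])$, and $K''$ is Lipschitz on $[-1,1]$. $\mathrm{IMSE}=\int_0^1\mathbb E[(\hat g_n^{trap}(x)-g(x))^2]w(x)\,dx$. In its asymptotic expression the design density $f$ enters the leading terms only through a term proportional to $\int_0^1\frac{\alpha(x)}{f^2(x)}w(x)\,dx$; ''optimal with respect to the asymptotic IMSE'' means minimizing this functional over the positive densities $f$ on $[0,1]$.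
   Formalization: It is assumed that αw is not identically zero (else the formula for f* is undefined), and f* is said to lie in the argmin over f>0 only when αw>0 on [0,1] (else f* has zeros); in general f* attains the infimum and any minimizer equals f* almost everywhere. *)

(* Defs.v *)
From HB Require Import structures.
From mathcomp Require Export all_boot all_order all_algebra.
From mathcomp Require Export all_classical all_reals all_analysis.
Export Order.TTheory GRing.Theory Num.Theory.
Export numFieldNormedType.Exports.

Set Implicit Arguments.
Unset Strict Implicit.
Unset Printing Implicit Defensive.

Local Open Scope classical_set_scope.
Local Open Scope ring_scope.

Definition I01 (R : realType) : set R := `[0, 1].
Arguments I01 {R}.

(* Derivative relative to [A]: one-sided at an endpoint of an interval. *)
Definition deriv_within (R : realType) (A : set R) (f : R -> R) (x l : R) :=
  (f y - f x) / (y - x) @[y --> within A x^'] --> l.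

Definition C2_Lip (R : realType) (A : set R) (f : R -> R) :=
  exists f1 f2 : R -> R,
    [/\ forall x, A x -> deriv_within A f x (f1 x),
        forall x, A x -> deriv_within A f1 x (f2 x),
        {within A, continuous f2}
      & exists k : R, k.-lipschitz_A f2].

(* Values outside [0, 1] are irrelevant. *)
Definition density (R : realType) : set (R -> R) :=
  [set f : R -> R | [/\ measurable_fun I01 f, forall t, I01 t -> 0 <= f t
             & (\int[lebesgue_measure]_(t in I01) (f t)%:E = 1)%E]].

Definition pos_density (R : realType) : set (R -> R) :=
  [set f : R -> R | density f /\ forall t, I01 t -> 0 < f t].

Arguments density {R}.
Arguments pos_density {R}.

Section processes.
Context d (T : measurableType d) (R : realType) (P : probability T R).

Definition centered_second_order (e : R -> {RV P >-> R}) :=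
  forall t, I01 t ->
    ('E_P[fun x => (e t x ^+ 2)%R] < +oo)%E /\ ('E_P[e t] = 0)%E.

Definition autocovariance (e : R -> {RV P >-> R}) (r : R -> R -> R) :=
  forall s t, I01 s -> I01 t -> ('E_P[fun x => (e s x * e t x)%R] = (r s t)%:E)%E.

Definition process_events (e : R -> {RV P >-> R}) : set (set T) :=
  <<s [set A | exists t (B : set R), [/\ I01 t, measurable B & A = e t @^-1` B]] >>.

(* Mutual independence of the sigma-algebras generated by the processes. *)
Definition independent_processes (e : nat -> R -> {RV P >-> R}) :=
  forall (J : seq nat) (A : nat -> set T), uniq J ->
    (forall j, j \in J -> process_events (e j) (A j)) ->
    (P (\big[setI/setT]_(j <- J) A j) = \prod_(j <- J) P (A j))%E.

End processes.

(* Equality of the finite-dimensional distributions on [0, 1]. *)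
Definition same_law d (T : measurableType d) d' (T' : measurableType d')
    (R : realType) (P : probability T R) (P' : probability T' R)
    (e : R -> {RV P >-> R}) (e' : R -> {RV P' >-> R}) :=
  forall (k : nat) (t : 'I_k -> R) (B : 'I_k -> set R),
    (forall i, I01 (t i)) -> (forall i, measurable (B i)) ->
    P (\big[setI/setT]_(i < k) (e (t i) @^-1` B i)) =
    P' (\big[setI/setT]_(i < k) (e' (t i) @^-1` B i)).

Section model.
Context (R : realType).
Implicit Types (f g K w alpha : R -> R).

Definition design_density f :=
  [/\ density f,
      exists2 c, 0 < c & forall t, I01 t -> c <= f t
    & exists M, forall t, I01 t -> f t <= M].

(* [tn n i] is [F^-1 (i/n)], [F] the distribution function of [f] ([F] is
   injective on [0, 1] since [f] is bounded below). *)
Definition regular_designs f (tn : nat -> nat -> R) :=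
  forall n i, (1 <= i <= n)%N ->
    I01 (tn n i) /\
    (\int[lebesgue_measure]_(u in `[0%R, tn n i]) (f u)%:E = (i%:R / n%:R)%R%:E)%E.

(* The design points of the window are listed increasingly since [t] is
   increasing; their number is [size pts]. *)
Definition trapezoidal_estimator K f (n : nat) (h : R) (t : nat -> R)
    (Ybar : R -> R) (x : R) : R :=
  let pts := [seq u <- [seq t i | i <- iota 1 n] | x - h <= u <= x + h] in
  let q u := h^-1 * K ((x - u) / h) / f u * Ybar u in
  (2 * n%:R)^-1 *
    \sum_(k < (size pts).-1) (q (nth 0 pts k) + q (nth 0 pts k.+1)).

Definition IMSE d (T : measurableType d) (P : probability T R)
    (ghat : R -> T -> R) g w : \bar R :=
  (\int[lebesgue_measure]_(x in I01)
     ('E_P[fun o => ((ghat x o - g x) ^+ 2)%R] * (w x)%:E))%E.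

Definition continuous_autocovariance (r : R -> R -> R) :=
  {within I01 `*` I01, continuous (fun p : R * R => r p.1 p.2)}.

(* [D i j] stands for R^(i,j).  At t = 0 (resp. t = 1) there is no left
   (resp. right) derivative, so the jump formula is imposed on ]0, 1[ and
   [alpha] is its continuous extension to [0, 1]. *)
Definition diagonal_jump (D : nat -> nat -> R -> R -> R) alpha :=
  exists dl dr : R -> R,
    [/\ (forall t : R, 0 < t <= 1 -> D 0%N 1%N t s @[s --> t^'-] --> dl t),
        (forall t : R, 0 <= t < 1 -> D 0%N 1%N t s @[s --> t^'+] --> dr t),
        {within `]0, 1], continuous dl} /\ {within `[0, 1[, continuous dr},
        (forall t : R, 0 < t < 1 -> alpha t = dl t - dr t)
      & {within I01, continuous alpha} /\ exists2 t, I01 t & alpha t != 0].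

Definition off_diagonal : set (R * R) :=
  [set p | [/\ I01 p.1, I01 p.2 & p.1 != p.2]].

(* [D i j] is the partial derivative of [r] of order [i] in the first and [j]
   in the second variable; only its off-diagonal values matter, except for
   [D 0 0]. *)
Definition smooth_off_diagonal (r : R -> R -> R) (D : nat -> nat -> R -> R -> R) :=
  [/\ (forall t s, I01 t -> I01 s -> D 0%N 0%N t s = r t s),
      (forall i j t s, (i + j <= 1)%N -> off_diagonal (t, s) ->
         deriv_within I01 (fun t' => D i j t' s) t (D i.+1 j t s) /\
         deriv_within I01 (D i j t) s (D i j.+1 t s)),
      (forall i j, (i + j <= 2)%N ->
         {within off_diagonal, continuous (fun p : R * R => D i j p.1 p.2)})
    & (forall i j, (i + j <= 2)%N ->
         exists M, forall t s, off_diagonal (t, s) -> `|D i j t s| <= M)].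

Definition kernel_function K :=
  closure [set u | K u != 0] = `[-1, 1]%classic /\
  (lebesgue_measure.-integrable setT (EFin \o K) /\
   (\int[lebesgue_measure]_u (K u)%:E = 1)%E).

Definition even_smooth_kernel K :=
  (forall u, K (- u) = K u) /\ C2_Lip `[-1, 1] K.

(* [x / 0 = 0], so a point where both [alpha * w] and [f] vanish contributes
   nothing. *)
Definition design_criterion alpha w f : \bar R :=
  (\int[lebesgue_measure]_(x in I01) (alpha x / f x ^+ 2 * w x)%R%:E)%E.

Definition argmin (X : Type) (A : set X) (J : X -> \bar R) : set X :=
  [set x | A x /\ forall y, A y -> (J x <= J y)%E].

Definition optimal_density alpha w (t : R) : R :=
  (alpha t * w t) `^ 3^-1 /
  (\int[lebesgue_measure]_(s in I01) ((alpha s * w s) `^ 3^-1))%R * \1_I01 t.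

End model.

(* Main.v *)
Require Import Defs.
From mathcomp Require Import ring lra measurable_realfun.

(** With [b = (alpha w)^(1/3)] and [c = \int b], every positive density [f]
    satisfies
      [\int b^3 / f^2 = c^3 + \int (b - c f)^2 (b + 2 c f) / f^2],
    because [b^3 / f^2 + 2 c^3 f - 3 c^2 b] is the last integrand.  Hence [c^3]
    is a lower bound, reached only when [f = b / c] almost everywhere; the
    positive densities [(b / c + e) / (1 + e)] show that it is the infimum even
    if [b] vanishes somewhere.
    Nonnegativity of [alpha] comes from the autocovariance: as [u] decreases to
    [t], [E (eps_u - eps_t)^2 / (u - t)] tends to [alpha t]. *)

Set Implicit Arguments.
Unset Strict Implicit.
Unset Printing Implicit Defensive.

Local Open Scope classical_set_scope.
Local Open Scope ring_scope.

(** * The minimization problem over an arbitrary measure space *)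

Lemma measurable_fun_exprV d (T : measurableType d) (R : realType) (D : set T)
    (f : T -> R) (n : nat) : measurable D ->
  measurable_fun D f -> (forall x, D x -> 0 <= f x) ->
  measurable_fun D (fun x => f x ^- n).
Proof.
move=> mD mf f0.
apply: (eq_measurable_fun (fun x => f x `^ (- n%:R))) => [x|].
  by rewrite inE => /f0 fx; rewrite powR_invn.
exact: (measurableT_comp (measurable_powR _) mf).
Qed.

Section variational.
Context d (T : measurableType d) (R : realType) (mu : {measure set T -> \bar R}).
Variables (D : set T) (b : T -> R) (c : R).
Hypotheses (mD : measurable D) (mb : measurable_fun D b).
Hypotheses (b0 : forall x, D x -> 0 <= b x) (c0 : 0 < c).
Hypothesis intb : (\int[mu]_(x in D) (b x)%:E = c%:E)%E.

(** Deficit in the arithmetic-geometric mean inequality for [b^3 / f^2], [c^3 f], [c^3 f], whose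
    geometric mean is [c^2 b]. *)
Let gap (f : T -> R) x :=
  b x ^+ 3 / f x ^+ 2 + 2 * c ^+ 3 * f x - 3 * c ^+ 2 * b x.

Let gapE (f : T -> R) x : 0 < f x ->
  gap f x = (b x - c * f x) ^+ 2 * (b x + 2 * c * f x) / f x ^+ 2.
Proof. by move=> f0; rewrite /gap; field; rewrite gt_eqF. Qed.

Let gap_ge0 (f : T -> R) x : D x -> 0 < f x -> 0 <= gap f x.
Proof.
move=> Dx f0; rewrite gapE// divr_ge0 ?sqr_ge0// mulr_ge0 ?sqr_ge0//.
by rewrite addr_ge0 ?b0// mulr_ge0 ?(ltW f0)// mulr_ge0 // ltW.
Qed.

Let gap_eq0 (f : T -> R) x : D x -> 0 < f x -> gap f x = 0 -> f x = b x / c.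
Proof.
move=> Dx f0; rewrite gapE// => /eqP.
rewrite mulf_eq0 invr_eq0 sqrf_eq0 (gt_eqF f0) orbF mulf_eq0 sqrf_eq0.
case/orP => [|/eqP h]; first by rewrite subr_eq0 => /eqP ->; field; rewrite gt_eqF.
(* The other factor, [b x + 2 * c * f x], is positive and cannot vanish. *)
have := b0 Dx; have : 0 < c * f x by exact: mulr_gt0.
by rewrite -mulrA in h; lra.
Qed.

Let mcrit (f : T -> R) : measurable_fun D f -> (forall x, D x -> 0 < f x) ->
  measurable_fun D (fun x => b x ^+ 3 / f x ^+ 2).
Proof.
move=> mf f0; apply: measurable_funM; first exact: measurable_funX.
by apply: measurable_fun_exprV => // x /f0/ltW.
Qed.

Let mgap (f : T -> R) : measurable_fun D f -> (forall x, D x -> 0 < f x) ->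
  measurable_fun D (gap f).
Proof.
move=> mf f0; apply: measurable_funB; last exact: measurable_funM.
by apply: measurable_funD; [exact: mcrit|exact: measurable_funM].
Qed.

(** The criterion may be infinite, so the identity is first arranged with nonnegative terms on both
    sides, where integrals add without integrability; only a finite constant is then subtracted. *)
Let criterion_gap (f : T -> R) : measurable_fun D f -> (forall x, D x -> 0 < f x) ->
  (\int[mu]_(x in D) (f x)%:E = 1)%E ->
  (\int[mu]_(x in D) (b x ^+ 3 / f x ^+ 2)%:E =
   (c ^+ 3)%:E + \int[mu]_(x in D) (gap f x)%:E)%E.
Proof.
move=> mf f0 intf.
have key : (\int[mu]_(x in D) ((b x ^+ 3 / f x ^+ 2)%:E + (2 * c ^+ 3)%:E * (f x)%:E) =
    \int[mu]_(x in D) ((3 * c ^+ 2)%:E * (b x)%:E + (gap f x)%:E))%E.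
  by apply: eq_integral => x _; rewrite -!EFinM -!EFinD; congr EFin; rewrite /gap; ring.
have c3 : 0 <= c ^+ 3 by rewrite exprn_ge0 // ltW.
have c2 : 0 <= c ^+ 2 by rewrite exprn_ge0 // ltW.
have c3' : 0 <= 2 * c ^+ 3 by rewrite mulr_ge0.
have c2' : 0 <= 3 * c ^+ 2 by rewrite mulr_ge0.
move: key; rewrite ge0_integralD//; first last.
- by apply: measurable_funeM; apply/measurable_EFinP.
- by move=> x Dx; rewrite -EFinM lee_fin mulr_ge0 // ltW // f0.
- by apply/measurable_EFinP; exact: mcrit.
- by move=> x Dx; rewrite lee_fin divr_ge0 ?exprn_ge0 ?b0 ?(ltW (f0 _ _)).
rewrite ge0_integralD//; first last.
- by apply/measurable_EFinP; exact: mgap.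
- by move=> x Dx; rewrite lee_fin gap_ge0 ?f0.
- by apply: measurable_funeM; apply/measurable_EFinP.
- by move=> x Dx; rewrite -EFinM lee_fin mulr_ge0 // b0.
rewrite ge0_integralZl_EFin//; first last.
- by apply/measurable_EFinP.
- by move=> x Dx; rewrite lee_fin ltW // f0.
rewrite ge0_integralZl_EFin//; first last.
- by apply/measurable_EFinP.
rewrite intf intb mule1 -EFinM.
set I := integral _ _ _; set G := integral _ _ _ => IG.
have -> : (I = (I + (2 * c ^+ 3)%:E) - (2 * c ^+ 3)%:E)%E by rewrite addeK.
rewrite IG addeAC -EFinD; congr (_%:E + _)%E; ring.
Qed.

Lemma criterion_ge (f : T -> R) : measurable_fun D f -> (forall x, D x -> 0 < f x) ->
  (\int[mu]_(x in D) (f x)%:E = 1)%E ->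
  ((c ^+ 3)%:E <= \int[mu]_(x in D) (b x ^+ 3 / f x ^+ 2)%:E)%E.
Proof.
move=> mf f0 intf; rewrite criterion_gap// leeDl// integral_ge0// => x Dx.
by rewrite lee_fin gap_ge0 ?f0.
Qed.

(** Equality leaves a zero integral for the nonnegative [gap f], which therefore vanishes almost
    everywhere. *)
Lemma criterion_min_unique (f : T -> R) :
  measurable_fun D f -> (forall x, D x -> 0 < f x) ->
  (\int[mu]_(x in D) (f x)%:E = 1)%E ->
  (\int[mu]_(x in D) (b x ^+ 3 / f x ^+ 2)%:E = (c ^+ 3)%:E)%E ->
  {ae mu, forall x, D x -> f x = b x / c}.
Proof.
move=> mf f0 intf; rewrite criterion_gap// => h.
have G0 : (\int[mu]_(x in D) `|(gap f x)%:E| = 0)%E.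
  under eq_integral => x /[!inE] Dx do rewrite gee0_abs ?lee_fin ?gap_ge0 ?f0//.
  have := congr1 (fun z => z - (c ^+ 3)%:E)%E h.
  by rewrite subee// addeAC subee// add0e.
move/ae_eq_integral_abs: G0 => /(_ mD) H.
have {}H := H _; have : measurable_fun D (EFin \o gap f).
  by apply/measurable_EFinP; exact: mgap.
move=> /H; apply: filterS => x /= hx Dx.
by apply: gap_eq0 => //; [exact: f0|have [] := hx Dx].
Qed.

Lemma criterion_min :
  (\int[mu]_(x in D) (b x ^+ 3 / (b x / c) ^+ 2)%:E = (c ^+ 3)%:E)%E.
Proof.
transitivity (\int[mu]_(x in D) ((c ^+ 2)%:E * (b x)%:E))%E.
  apply: eq_integral => x _; rewrite -EFinM; congr EFin.
  (* Where [b] vanishes, the convention [0 / 0 = 0] makes both integrands zero. *)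
  have [->|bx] := eqVneq (b x) 0; first by rewrite mul0r mulr0 expr0n mul0r.
  by field; rewrite bx gt_eqF.
rewrite ge0_integralZl_EFin ?intb -?EFinM -?exprSr//.
- exact/measurable_EFinP.
- by rewrite sqr_ge0.
Qed.

(** Since [c * (b / c + e) >= b], the integrand is at most [(1 + e)^2 c^2 b]; the bound tends to
    [c^3] with [e]. *)
Lemma criterion_mix e : 0 < e ->
  (\int[mu]_(x in D) (b x ^+ 3 / ((b x / c + e) / (1 + e)) ^+ 2)%:E <=
   ((1 + e) ^+ 2 * c ^+ 3)%:E)%E.
Proof.
move=> e0; have e1 : 0 < 1 + e by rewrite addr_gt0.
have u0 x : D x -> 0 < b x / c + e.
  by move=> Dx; rewrite ltr_wpDl// divr_ge0 ?b0// ltW.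
have -> : ((1 + e) ^+ 2 * c ^+ 3)%:E =
    (\int[mu]_(x in D) (((1 + e) ^+ 2 * c ^+ 2)%:E * (b x)%:E))%E.
  rewrite ge0_integralZl_EFin ?intb -?EFinM; first by congr EFin; ring.
  - by [].
  - by move=> x Dx; rewrite lee_fin b0.
  - exact/measurable_EFinP.
  - by rewrite mulr_ge0 ?sqr_ge0.
apply: ge0_le_integral => //.
- move=> x Dx; rewrite lee_fin divr_ge0 ?sqr_ge0// exprn_ge0// b0//.
- apply/measurable_EFinP; apply: mcrit => [|x Dx]; last by rewrite divr_gt0 ?u0.
  apply: measurable_funM => //; apply: measurable_funD => //.
  exact: measurable_funM.
- by apply: measurable_funeM; exact/measurable_EFinP.
- move=> x Dx; rewrite -EFinM lee_fin ler_pdivrMr ?exprn_gt0 ?divr_gt0 ?u0//.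
  set u := b x / c + e.
  have -> : (1 + e) ^+ 2 * c ^+ 2 * b x * (u / (1 + e)) ^+ 2 = b x * (c * u) ^+ 2.
    by field; rewrite gt_eqF.
  rewrite exprS ler_wpM2l ?b0// lerXn2r ?nnegrE ?b0//.
    by rewrite mulr_ge0 ?(ltW c0) ?(ltW (u0 _ Dx)).
  have -> : c * u = b x + c * e by rewrite /u; field; rewrite gt_eqF.
  by rewrite lerDl mulr_ge0 // ltW.
Qed.

End variational.

(** * Second moments of the increments of the error process *)

Section autocovariance.
Context d (T : measurableType d) (R : realType) (P : probability T R).
Variables (e : R -> {RV P >-> R}) (r : R -> R -> R).
Hypotheses (he : centered_second_order e) (hr : autocovariance e r).

Lemma autocovariance_sym s t : I01 s -> I01 t -> r s t = r t s.
Proof.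
move=> hs ht; apply: EFin_inj; rewrite -!hr//; congr expectation.
by apply/funext => x; rewrite mulrC.
Qed.

Let integrable_sqr t : I01 t -> P.-integrable setT (EFin \o (fun x => e t x ^+ 2)).
Proof.
move=> ht; apply/integrableP; split.
  by apply/measurable_EFinP; apply: measurable_funX; exact: measurable_funPT.
have [h _] := he ht; move: h; rewrite unlock => h.
under eq_integral do rewrite gee0_abs ?lee_fin ?sqr_ge0//.
exact: h.
Qed.

Let integrable_mul s t : I01 s -> I01 t ->
  P.-integrable setT (EFin \o (fun x => e s x * e t x)).
Proof.
move=> hs ht.
apply: (@le_integrable _ _ _ _ _ _ _ ((EFin \o (fun x => e s x ^+ 2)) \+
                                       (EFin \o (fun x => e t x ^+ 2)))) => //.
- by apply/measurable_EFinP; apply: measurable_funM; exact: measurable_funPT.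
- move=> x _ /=; rewrite lee_fin [leRHS]ger0_norm ?addr_ge0 ?sqr_ge0// ler_norml.
  by apply/andP; split; nra.
- by apply: integrableD => //; exact: integrable_sqr.
Qed.

(** This second difference is the expectation of [(e s - e t)^2]. *)
Lemma autocovariance_diff_ge0 s t : I01 s -> I01 t ->
  0 <= r s s - 2 * r s t + r t t.
Proof.
move=> hs ht.
have Es u v : I01 u -> I01 v -> (\int[P]_x (e u x * e v x)%:E = (r u v)%:E)%E.
  by move=> hu hv; rewrite -hr// unlock.
have : (0 <= \int[P]_x ((e s x - e t x) ^+ 2)%:E)%E.
  by apply: integral_ge0 => x _; rewrite lee_fin sqr_ge0.
have -> : (\int[P]_x ((e s x - e t x) ^+ 2)%:E =
  \int[P]_x ((e s x * e s x)%:E + (e t x * e t x)%:E - (2%:E * (e s x * e t x)%:E)))%E.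
  by apply: eq_integral => x _; rewrite -EFinM -EFinN -!EFinD; congr EFin; ring.
rewrite integralB//; first last.
- by apply: integrableZl => //; exact: integrable_mul.
- by apply: integrableD => //; exact: integrable_mul.
rewrite integralD//; try exact: integrable_mul.
rewrite integralZl//; try exact: integrable_mul.
rewrite !Es// -EFinM -EFinN -!EFinD lee_fin.
by rewrite addrAC.
Qed.

End autocovariance.

(** * Continuity and derivatives relative to the unit interval *)

Lemma I01E (R : realType) (x : R) : I01 x <-> 0 <= x <= 1.
Proof. by rewrite /I01 /= in_itv. Qed.

Lemma within_continuous_dist (R : realType) (A : set R) (f : R -> R) (x e : R) :
  {within A, continuous f} -> A x -> 0 < e ->
  exists2 d, 0 < d & forall y, A y -> `|x - y| < d -> `|f x - f y| < e.
Proof.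
move=> /subspace_continuousP cf Ax e0.
have /cvgrPdist_lt/(_ _ e0) := cf x Ax.
rewrite near_withinE => /nbhs_ballP[d /= d0 H]; exists d => // y Ay xy.
exact: H.
Qed.

Lemma deriv_within_is_derive (R : realType) (f : R -> R) (x l : R) :
  0 < x < 1 -> deriv_within I01 f x l -> is_derive x 1 f l.
Proof.
move=> x01 dfx.
suff H : (fun h : R => h^-1 *: ((f \o shift x) (h *: 1) - f x)) @ 0^' --> l.
  by apply: DeriveDef; [apply/cvg_ex; exists l|exact: cvg_lim].
apply/cvgrPdist_lt => e e0; move: dfx => /cvgrPdist_lt/(_ _ e0).
rewrite !near_withinE => /nbhs_ballP[d /= d0 H].
have [/andP[x0 x1]] := x01.
(* The bounds [x] and [1 - x] keep [h + x] inside the unit interval. *)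
apply/nbhs_ballP; exists (Num.min d (Num.min x (1 - x))) => /=.
  by rewrite !lt_min d0 x0 subr_gt0.
move=> h; rewrite /ball/= sub0r normrN !lt_min => /and3P[hd].
rewrite !ltr_norml => /andP[hx _] /andP[_ hx1] h0.
have := H (h + x); rewrite /ball /= opprD addrCA subrr addr0 normrN.
rewrite addrK mulrC => Hh; rewrite /= [h *: 1]mulr1; rewrite -ltr_norml; apply: Hh => //.
- by rewrite -subr_eq0 addrK.
- by apply/I01E; apply/andP; split; lra.
Qed.

(** * Sign of the jump of the derivative across the diagonal *)

Section jump.
Context (R : realType) (r : R -> R -> R) (D : nat -> nat -> R -> R -> R).
Hypotheses (rC : continuous_autocovariance r) (rD : smooth_off_diagonal r D).

Let r_continuous t : I01 t -> {within I01, continuous (r t)}.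
Proof.
move=> ht; apply/subspace_continuousP => s hs.
move: rC => /subspace_continuousP/(_ (t, s)) /(_ (conj ht hs)) H.
move=> U /H [[A B] [/= nA nB] AB]; apply: filterS nB => y By hy.
by apply: (AB (t, y)) => //; split => //; exact: nbhs_singleton nA.
Qed.

Let r_is_derive t s : I01 t -> 0 < s < 1 -> t != s ->
  is_derive s 1 (r t) (D 0%N 1%N t s).
Proof.
move=> ht hs ts; have [r0 r1 _ _] := rD.
have s01 : I01 s by apply/I01E; case/andP: hs => /ltW -> /ltW ->.
have [_ /deriv_within_is_derive - /(_ hs)] := r1 0%N 0%N t s isT (And3 ht s01 ts).
(* [D 0 0 t] and [r t] are known to agree only on the unit interval, a neighbourhood of [s]. *)
apply: near_eq_is_derive; have [s0 s1] := andP hs.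
near=> u; apply: r0 => //; apply/I01E/andP; split; apply/ltW; near: u.
  exact: lt_nbhsr.
exact: lt_nbhsl.
Unshelve. all: by end_near. Qed.

Let D01_is_derive t s : I01 t -> 0 < s < 1 -> t != s ->
  is_derive s 1 (D 0%N 1%N t) (D 0%N 2%N t s).
Proof.
move=> ht hs ts; have [_ r1 _ _] := rD.
have s01 : I01 s by apply/I01E; case/andP: hs => /ltW -> /ltW ->.
by have [_ /deriv_within_is_derive - /(_ hs)] := r1 0%N 1%N t s isT (And3 ht s01 ts).
Qed.

(** The diagonal point [t] may be an endpoint: there the mean value theorem asks only for continuity
    of [r t]. *)
Let r_mvt t a b : I01 t -> 0 <= a -> a < b -> b <= 1 -> (t <= a) || (b <= t) ->
  exists2 x, a < x < b & r t b - r t a = D 0%N 1%N t x * (b - a).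
Proof.
move=> ht a0 ab b1 tab.
have [||x xab E] := @MVT R (r t) (D 0%N 1%N t) a b ab.
- move=> x; rewrite in_itv/= => /andP[ax xb]; apply: r_is_derive => //.
    by apply/andP; split; lra.
  by apply: contraL tab => /eqP ->; rewrite negb_or -!ltNge ax xb.
- apply: continuous_subspaceW (r_continuous ht) => x /=; rewrite in_itv/=.
  by move=> /andP[? ?]; apply/I01E/andP; split; lra.
by exists x.
Qed.

(** Here [t] must avoid the closed interval, because [D 0 1 t] may jump at [t]. *)
Let D01_lip t a b M : (forall t s, off_diagonal (t, s) -> `|D 0%N 2%N t s| <= M) ->
  I01 t -> 0 < a -> a < b -> b < 1 -> (t < a) || (b < t) ->
  `|D 0%N 1%N t b - D 0%N 1%N t a| <= M * (b - a).
Proof.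
move=> hM ht a0 ab b1 tab.
have ne x : a <= x <= b -> t != x.
  move=> /andP[ax xb]; apply: contraL tab => /eqP ->.
  by rewrite negb_or -!leNgt ax xb.
have der x : a <= x <= b -> is_derive x 1 (D 0%N 1%N t) (D 0%N 2%N t x).
  move=> xab; apply: D01_is_derive => //; last exact: ne.
  by case/andP: xab => ? ?; apply/andP; split; lra.
have [||x] := @MVT R (D 0%N 1%N t) (D 0%N 2%N t) a b ab.
- by move=> x; rewrite in_itv/= => /andP[/ltW ax /ltW xb]; apply: der; rewrite ax.
- apply: derivable_within_continuous => x; rewrite in_itv/= => xab.
  by case: (der x xab).
rewrite in_itv/= => /andP[ax xb] ->; rewrite normrM.
rewrite (gtr0_norm (_ : 0 < b - a)) ?subr_gt0//.
rewrite ler_wpM2r ?subr_ge0 ?(ltW ab)//; apply: hM; split => //=.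
  by apply/I01E/andP; split; lra.
by apply: ne; rewrite !ltW.
Qed.

(* For [t < u] the mean value theorem gives points [x, y] of [`]t, u[] with
   [r u u - 2 r t u + r t t = (D01 u x - D01 t y) (u - t)]; the bound [M] on the
   second derivative makes [D01 u x] close to [dl u], whence to [dl t]. *)
Lemma jump_ge0 alpha : diagonal_jump D alpha ->
  (forall t s, I01 t -> I01 s -> r t s = r s t) ->
  (forall t s, I01 t -> I01 s -> 0 <= r t t - 2 * r t s + r s s) ->
  forall t, I01 t -> 0 <= alpha t.
Proof.
move=> [dl [dr [hl hr [cl _] alphaE [calpha _]]]] rsym rpos.
have [_ _ _ /(_ 0%N 2%N isT)[M hM]] := rD.
(* Only at interior points is [alpha] the difference [dl - dr]; the endpoints follow by
   continuity. *)
have interior t : 0 < t < 1 -> 0 <= alpha t.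
  move=> t01; have [t0 t1] := andP t01.
  rewrite leNgt; apply/negP => an.
  (* Four errors below [e] will accumulate: two in [D1], one each in [D2] and [D3]. *)
  pose e := - alpha t / 4; have e0 : 0 < e by rewrite divr_gt0 ?oppr_gt0.
  have [d1 d10 H1] : exists2 d, 0 < d &
      forall s, t < s < t + d -> `|dr t - D 0%N 1%N t s| < e.
    have := hr t; rewrite (ltW t0) t1 => /(_ isT) /cvgrPdist_lt/(_ _ e0).
    rewrite near_withinE => /nbhs_ballP[d /= d0 H]; exists d => // s /andP[ts sd].
    by apply: H => //; rewrite /ball/= ltr_norml; apply/andP; split; lra.
  have t01' : `]0, 1]%classic t by rewrite /= in_itv/= t0 ltW.
  have [d2 d20 H2] := within_continuous_dist cl t01' e0.
  (* [d1] and [d2] control [dr] and [dl] near [t], [1 - t] keeps [u] below 1, and the last bound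
     gives [M * h < e]; halving makes all of them strict. *)
  pose h := Num.min (Num.min d1 d2) (Num.min (1 - t) (e / (`|M| + 1))) / 2.
  have M0 : 0 < `|M| + 1 by rewrite ltr_wpDl.
  have h0 : 0 < h by rewrite divr_gt0 // !lt_min d10 d20 subr_gt0 t1 divr_gt0.
  have : h < Num.min (Num.min d1 d2) (Num.min (1 - t) (e / (`|M| + 1))).
    by move: h0; rewrite /h; lra.
  rewrite !lt_min => /andP[/andP[hd1 hd2] /andP[h1]].
  rewrite ltr_pdivlMr// => hM1.
  have {hM1}Mh : M * h < e.
    by apply: le_lt_trans hM1; rewrite mulrC ler_wpM2l ?(ltW h0)// ler_wpDr// ler_norm.
  pose u := t + h.
  have It : I01 t by apply/I01E/andP; split; exact: ltW.
  have Iu : I01 u by apply/I01E/andP; rewrite /u; split; lra.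
  have tu : t < u by rewrite /u; lra.
  have u1 : u < 1 by rewrite /u; lra.
  have [|x /andP[tx xu] E1] := r_mvt Iu (ltW t0) tu (ltW u1); first by rewrite lexx orbT.
  have [|y /andP[ty yu] E2] := r_mvt It (ltW t0) tu (ltW u1); first by rewrite lexx.
  have Ix : I01 x by apply/I01E/andP; split; lra.
  (* [x] need not be close enough to [u] for the limit [dl u]; a point [s] of []x, u[] is, and
     [D01_lip] carries the estimate back to [x]. *)
  have D1 : D 0%N 1%N u x < dl u + e + M * h.
    have hl' := hl u; have u01 : 0 < u <= 1 by apply/andP; split; lra.
    have /cvgrPdist_lt/(_ _ e0) := hl' u01.
    rewrite near_withinE => /nbhs_ballP[d /= d0 H].
    pose s := u - Num.min d (u - x) / 2.
    have m0 : 0 < Num.min d (u - x) by rewrite lt_min d0 subr_gt0.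
    have : Num.min d (u - x) <= u - x by rewrite ge_min lexx orbT.
    have : Num.min d (u - x) <= d by rewrite ge_min lexx.
    set m := Num.min _ _ in s m0 * => md mx.
    have us : `|dl u - D 0%N 1%N u s| < e.
      apply: H; last by rewrite /s; lra.
      by rewrite /ball/= /s ltr_norml; apply/andP; split; lra.
    have xs : x < s by rewrite /s; lra.
    have su : s < u by rewrite /s; lra.
    have := D01_lip hM Iu (lt_trans t0 tx) xs (lt_trans su u1) _.
    rewrite su orbT => /(_ isT); rewrite ler_norml => /andP[L1 _].
    move: us; rewrite ltr_norml => /andP[L2 _].
    have : M * (s - x) <= M * h.
      apply: ler_wpM2l; last by rewrite /u in su; lra.
      (* [M] is nonnegative, as it bounds an absolute value at the off-diagonal point [(u, x)]. *)
      apply: (le_trans (normr_ge0 (D 0%N 2%N u x))); apply: hM.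
      by split; rewrite //= gt_eqF.
    lra.
  have D2 : dr t < D 0%N 1%N t y + e.
    have yd : t < y < t + d1 by rewrite ty (lt_trans yu)// /u ltrD2l.
    by move: (H1 y yd); rewrite ltr_norml => /andP[]; lra.
  have D3 : dl u < dl t + e.
    have Hu : `]0, 1]%classic u by rewrite /= in_itv/= (lt_trans t0 tu) ltW.
    have tud : `|t - u| < d2 by rewrite ltr_norml /u; apply/andP; split; lra.
    by move: (H2 u Hu tud); rewrite ltr_norml => /andP[]; lra.
  have al : alpha t = dl t - dr t by exact: alphaE.
  have : 0 <= (D 0%N 1%N u x - D 0%N 1%N t y) * h.
    have := rpos u t Iu It; have := rsym u t Iu It.
    have -> : h = u - t by rewrite /u; ring.
    by rewrite mulrBl -E1 -E2; lra.
  rewrite pmulr_lge0//; rewrite /e in D1 D2 D3 Mh; lra.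
move=> t It; rewrite leNgt; apply/negP => an.
have e0 : 0 < - alpha t by rewrite oppr_gt0.
have [d d0 H] := within_continuous_dist calpha It e0.
pose k := Num.min d 1 / 2.
have m0 : 0 < Num.min d 1 by rewrite lt_min d0/=.
have md : Num.min d 1 <= d by rewrite ge_min lexx.
have m1 : Num.min d 1 <= 1 by rewrite ge_min lexx orbT.
have {m0 md m1}[k0 kd k1] : [/\ 0 < k, k < d & k < 1].
  by rewrite /k; move: m0 md m1; set m := Num.min _ _ => *; split; lra.
have /I01E/andP[t0 t1] := It.
(* Moving [t] towards the midpoint gives an interior point at distance at most [k / 2 < d]. *)
pose y := t + (2^-1 - t) * k.
have y01 : 0 < y < 1 by rewrite /y; apply/andP; split; nra.
have Iy : I01 y by apply/I01E; case/andP: y01 => /ltW -> /ltW ->.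
have := H y Iy; have -> : `|t - y| < d.
  by rewrite ltr_norml /y; apply/andP; split; nra.
move=> /(_ isT); rewrite ltr_norml => /andP[L _].
have := interior y y01; lra.
Qed.

End jump.

(** * Integrals of powers of continuous functions on the unit interval *)

Lemma lebesgue_measure_I01 (R : realType) : lebesgue_measure (@I01 R) = 1%E.
Proof. by rewrite /I01 lebesgue_measure_itv /= lte_fin ltr01 -EFinB subr0. Qed.

Lemma measurable_I01 (R : realType) : measurable (@I01 R).
Proof. exact: measurable_itv. Qed.
#[local] Hint Extern 0 (measurable _) => solve [exact: measurable_I01] : core.

Lemma within_continuousM (R : realType) (A : set R) (f g : R -> R) :
  {within A, continuous f} -> {within A, continuous g} ->
  {within A, continuous (fun x => f x * g x)}.
Proof. by move=> cf cg x; apply: cvgM; [exact: cf|exact: cg]. Qed.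

Section power_of_continuous.
Context (R : realType) (a : R -> R) (p : R).
Hypotheses (ca : {within I01, continuous a}) (a0 : forall t, I01 t -> 0 <= a t).
Hypothesis p01 : 0 <= p <= 1.

Lemma measurable_powR_continuous : measurable_fun I01 (fun t => a t `^ p).
Proof.
apply: (measurableT_comp (measurable_powR p)).
exact: subspace_continuous_measurable_fun.
Qed.

(** For an exponent in [[0, 1]] the power is at most [1 + a], which is continuous on a segment. *)
Lemma integrable_powR_continuous :
  lebesgue_measure.-integrable I01 (EFin \o (fun t => a t `^ p)).
Proof.
apply: (@le_integrable _ _ R (@lebesgue_measure R) I01 _ _
  (EFin \o (fun t => 1 + a t))) => //.
- by apply/measurable_EFinP; exact: measurable_powR_continuous.
- move=> t It /=; rewrite lee_fin !ger0_norm ?powR_ge0 ?addr_ge0 ?a0//.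
  have [_ p1] := andP p01.
  have [a1|a1] := leP 1 (a t).
    by apply: (le_trans (ler1_powR a1 p1)); rewrite lerDr.
  have [->|an0] := eqVneq (a t) 0.
    by rewrite addr0 /powR eqxx; case: (p == 0).
  rewrite ler_wpDr ?a0// -[leRHS](powRr0 (a t)) ger_powR//.
  by rewrite lt_neqAle eq_sym an0 a0//= ltW.
  by case/andP: p01.
- apply: continuous_compact_integrable; first exact: segment_compact.
  by move=> x; apply: cvgD; [exact: cvg_cst|exact: ca].
Qed.

Lemma integral_powR_continuous_gt0 : (exists2 t, I01 t & a t != 0) ->
  (0 < \int[lebesgue_measure]_(t in I01) (a t `^ p)%:E)%E.
Proof.
move=> [t It at0].
have at_gt0 : 0 < a t by rewrite lt_neqAle eq_sym at0 a0.
have at2 : 0 < a t / 2 by rewrite divr_gt0.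
have [d d0 H] := within_continuous_dist ca It at2.
have /I01E/andP[t0 t1] := It.
(* On this interval [a] exceeds [a t / 2]; truncation to [[0, 1]] leaves positive length even when
   [t] is an endpoint. *)
pose l := Num.max 0 (t - d / 2); pose u := Num.min 1 (t + d / 2).
have lu : l < u.
  by rewrite /l /u lt_min !gt_max; apply/andP; split; apply/andP; split; lra.
have luI : `[l, u]%classic `<=` I01.
  move=> x; rewrite /= in_itv/= /l /u ge_max le_min.
  by move=> /andP[/andP[x0 _] /andP[x1 _]]; apply/I01E; rewrite x0.
have k0 : 0 < (a t / 2) `^ p by exact: powR_gt0.
apply: (@lt_le_trans _ _ (\int[lebesgue_measure]_(x in `[l, u]) ((a t / 2) `^ p)%:E)%E).
  rewrite integral_cst//= lebesgue_measure_itv /= lte_fin lu -EFinB -EFinM lte_fin.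
  by rewrite mulr_gt0 ?subr_gt0.
apply: (@le_trans _ _ (\int[lebesgue_measure]_(x in `[l, u]) (a x `^ p)%:E)%E);
  last first.
  apply: ge0_subset_integral => //.
  - by apply/measurable_EFinP; exact: measurable_powR_continuous.
  - by move=> x _; rewrite lee_fin powR_ge0.
apply: ge0_le_integral => //.
- by move=> x _; rewrite lee_fin ltW.
- apply/measurable_EFinP.
  by apply: measurable_funS measurable_powR_continuous.
- move=> x xlu; have Ix : I01 x by exact: luI.
  have tx : `|t - x| < d.
    move: xlu; rewrite /= in_itv/= /l /u ge_max le_min ltr_norml.
    by move=> /andP[/andP[_ ?] /andP[_ ?]]; apply/andP; split; lra.
  have {tx} := H x Ix tx; rewrite ltr_norml => /andP[_ ax].
  have p0 : 0 <= p by case/andP: p01.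
  rewrite lee_fin ge0_ler_powR ?nnegrE ?(ltW at2) ?a0//.
  by move: (a x) ax => y; lra.
Qed.

End power_of_continuous.

(** * The optimal density and the infimum of the design criterion *)

Section optimal_density.
Context (R : realType) (alpha w : R -> R).
Hypotheses (calpha : {within I01, continuous alpha}) (cw : {within I01, continuous w}).
Hypotheses (aw0 : forall t, I01 t -> 0 <= alpha t * w t).
Hypothesis aw_neq0 : exists2 t, I01 t & alpha t * w t != 0.

Let b t := (alpha t * w t) `^ 3^-1.
Let c := (\int[lebesgue_measure]_(t in I01) b t)%R.

Let caw : {within I01, continuous (fun t => alpha t * w t)}.
Proof. exact: within_continuousM. Qed.

Let p01 : 0 <= (3^-1 : R) <= 1. Proof. by apply/andP; split; lra. Qed.

Let intb : (\int[lebesgue_measure]_(t in I01) (b t)%:E = c%:E)%E.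
Proof.
rewrite fineK//; apply: integrable_fin_num => //.
exact: integrable_powR_continuous.
Qed.

Let c0 : 0 < c.
Proof. by rewrite -lte_fin -intb; exact: integral_powR_continuous_gt0. Qed.

Let mb : measurable_fun I01 b. Proof. exact: measurable_powR_continuous. Qed.

Let b0 t : I01 t -> 0 <= b t. Proof. by move=> _; exact: powR_ge0. Qed.

(** Cubing undoes the real power because the base is nonnegative. *)
Let b3 t : I01 t -> b t ^+ 3 = alpha t * w t.
Proof.
by move=> It; rewrite -powR_mulrn ?b0// -powRrM mulVf ?pnatr_eq0// powRr1 ?aw0.
Qed.

Let optimalE t : I01 t -> optimal_density alpha w t = b t / c.
Proof. by move=> It; rewrite /optimal_density indicE mem_set// mulr1. Qed.

Let criterionE (f g : R -> R) : (forall t, I01 t -> f t = g t) ->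
  design_criterion alpha w f =
  (\int[lebesgue_measure]_(t in I01) (b t ^+ 3 / g t ^+ 2)%:E)%E.
Proof.
move=> fg; apply: eq_integral => t /[!inE] It.
by rewrite b3// fg// mulrAC.
Qed.

Lemma optimal_density_density : density (optimal_density alpha w).
Proof.
split.
- apply: (eq_measurable_fun (fun t => b t / c)); last exact: measurable_funM.
  by move=> t /[!inE] It; rewrite optimalE.
- by move=> t It; rewrite optimalE// divr_ge0 ?b0 ?(ltW c0).
- transitivity (\int[lebesgue_measure]_(t in I01) (c^-1%:E * (b t)%:E))%E.
    apply: eq_integral => t /[!inE] It; rewrite optimalE// -EFinM.
    by rewrite mulrC.
  rewrite ge0_integralZl_EFin ?intb -?EFinM ?mulVf ?gt_eqF//.
  + exact/measurable_EFinP.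
  + by rewrite invr_ge0 ltW.
Qed.

Lemma optimal_density_gt0 t : I01 t -> 0 < alpha t * w t ->
  0 < optimal_density alpha w t.
Proof. by move=> It aw; rewrite optimalE// divr_gt0 // powR_gt0. Qed.

Lemma design_criterion_optimal :
  design_criterion alpha w (optimal_density alpha w) = (c ^+ 3)%:E.
Proof. by rewrite (criterionE optimalE); exact: criterion_min. Qed.

Lemma design_criterion_ge f : pos_density f ->
  ((c ^+ 3)%:E <= design_criterion alpha w f)%E.
Proof.
move=> [[mf _ intf] f0]; rewrite (criterionE (fun _ _ => erefl)).
exact: criterion_ge.
Qed.

Lemma design_criterion_min_unique f : pos_density f ->
  design_criterion alpha w f = (c ^+ 3)%:E ->
  {ae lebesgue_measure, forall t, I01 t -> f t = optimal_density alpha w t}.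
Proof.
move=> [[mf _ intf] f0]; rewrite (criterionE (fun _ _ => erefl)) => h.
have := @criterion_min_unique _ _ R (@lebesgue_measure R) I01 b c
  (@measurable_I01 R) mb b0 c0 intb f mf f0 intf h.
by apply: filterS => t H It; rewrite H// optimalE.
Qed.

(** On the unit interval [b / c] has mass 1 and the constant [e] mass [e], whence the divisor
    [1 + e]. *)
Let mix_pos_density e : 0 < e -> pos_density (fun t => (b t / c + e) / (1 + e)).
Proof.
move=> e0; have e1 : 0 < 1 + e by rewrite addr_gt0.
have f0 t : I01 t -> 0 < (b t / c + e) / (1 + e).
  by move=> It; rewrite divr_gt0 // ltr_wpDl// divr_ge0 ?b0// ltW.
split => //; split => [|t /f0/ltW//|].
  by apply: measurable_funM => //; apply: measurable_funD => //; exact: measurable_funM.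
transitivity (\int[lebesgue_measure]_(t in I01)
    ((c * (1 + e))^-1%:E * (b t)%:E + (e / (1 + e))%:E))%E.
  apply: eq_integral => t _; rewrite -EFinM -EFinD; congr EFin.
  by field; rewrite !gt_eqF.
rewrite ge0_integralD//.
- rewrite ge0_integralZl_EFin//.
  + rewrite intb integral_cst//= lebesgue_measure_I01 mule1 -EFinM -EFinD.
    by congr EFin; field; rewrite !gt_eqF.
  + exact/measurable_EFinP.
  + by rewrite invr_ge0 mulr_ge0 // ltW.
- by move=> t It; rewrite -EFinM lee_fin mulr_ge0 ?b0// invr_ge0 mulr_ge0 // ltW.
- by apply: measurable_funeM; exact/measurable_EFinP.
- by move=> t _; rewrite lee_fin divr_ge0 // ltW.
Qed.

Lemma ereal_inf_design_criterion :
  ereal_inf (design_criterion alpha w @` pos_density) = (c ^+ 3)%:E.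
Proof.
apply/eqP; rewrite eq_le; apply/andP; split; last first.
  by apply: le_ereal_inf_tmp => _ [f hf <-]; exact: design_criterion_ge.
apply/lee_addgt0Pr => eta eta0.
have c3 : 0 < c ^+ 3 by exact: exprn_gt0.
(* For [e <= 1], [(1 + e)^2 <= 1 + 3 e], so the excess over [c^3] is at most [3 e c^3 <= eta]. *)
pose e := Num.min 1 (eta / (3 * c ^+ 3)).
have e0 : 0 < e by rewrite lt_min ltr01 divr_gt0 // mulr_gt0.
have e1 : e <= 1 by rewrite ge_min lexx.
have : e <= eta / (3 * c ^+ 3) by rewrite ge_min lexx orbT.
rewrite ler_pdivlMr ?mulr_gt0// => e_eta.
apply: (@le_trans _ _ ((1 + e) ^+ 2 * c ^+ 3)%:E); last first.
  rewrite -EFinD lee_fin.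
  have : e * (e * c ^+ 3) <= 1 * (e * c ^+ 3) by rewrite ler_wpM2r// mulr_ge0 // ltW.
  by move: (c ^+ 3) c3 e_eta => k k0; nra.
apply: (le_trans (ereal_inf_lbound (imageP _ (mix_pos_density e0)))).
rewrite (criterionE (fun _ _ => erefl)).
exact: criterion_mix.
Qed.

End optimal_density.

(** [fstar] vanishes where [alpha * w] does and may then leave the positive densities. Its value is
    therefore compared with the infimum, and membership in the argmin is asserted for positive
    [alpha * w]. Uniqueness is almost everywhere, as the criterion ignores null sets. *)
Theorem corollary1 (R : realType)
  (* the error process and its autocovariance *)
  (d0 : measure_display) (T0 : measurableType d0) (P0 : probability T0 R)
  (eps0 : R -> {RV P0 >-> R}) (r : R -> R -> R)
  (Heps0 : centered_second_order eps0) (Hr : autocovariance eps0 r)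
  (* i.i.d. copies and the observations *)
  (d : measure_display) (T : measurableType d) (P : probability T R)
  (eps : nat -> R -> {RV P >-> R})
  (Hindep : independent_processes eps)
  (Hlaw : forall j, same_law (eps j) eps0)
  (g : R -> R) (Y : nat -> R -> T -> R)
  (HY : forall j t o, Y j t o = g t + eps j t o)
  (* design, kernel, bandwidth, replication numbers, estimator *)
  (f : R -> R) (Hf : design_density f)
  (tn : nat -> nat -> R) (Htn : regular_designs f tn)
  (K : R -> R) (HK : kernel_function K)
  (h : nat -> nat -> R) (Hh : forall n k, 0 < h n k < 1)
  (m : nat -> nat)
  (ghat : nat -> R -> T -> R)
  (Hghat : forall n x o, ghat n x o =
     trapezoidal_estimator K f n (h n (m n)) (tn n)
       (fun t => (m n)%:R^-1 * \sum_(1 <= j < (m n).+1) Y j t o) x)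
  (w : R -> R) (Hw : density w) (Hwc : {within I01, continuous w})
  (imse : nat -> \bar R) (Himse : forall n, imse n = IMSE P (ghat n) g w)
  (* assumptions *)
  (D : nat -> nat -> R -> R -> R) (alpha : R -> R)
  (HA : continuous_autocovariance r) (HB : diagonal_jump D alpha)
  (HC : smooth_off_diagonal r D) (HD : even_smooth_kernel K)
  (Hf2 : C2_Lip I01 f) (Hg2 : C2_Lip I01 g)
  (HD02 : forall t, I01 t ->
     exists k : R, k.-lipschitz_(I01 `\ t) (D 0%N 2%N t))
  (Hm : ((m n)%:R : R) @[n --> \oo] --> +oo)
  (Hh0 : h n (m n) @[n --> \oo] --> 0)
  (Hnh : n%:R * h n (m n) @[n --> \oo] --> +oo)
  (Hnh2 : n%:R * h n (m n) ^+ 2 @[n --> \oo] --> +oo)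
  (Hnm : (n%:R / (m n)%:R : R) @[n --> \oo] --> +oo)
  (* the normalizing constant of the optimal density does not vanish *)
  (Haw : exists2 t, I01 t & alpha t * w t != 0) :
  let J := design_criterion alpha w in
  let fstar := optimal_density alpha w in
  [/\ density fstar,
      J fstar = ereal_inf (J @` pos_density),
      (forall t, I01 t -> 0 < alpha t * w t) -> argmin pos_density J fstar
    & forall f', argmin pos_density J f' ->
        {ae lebesgue_measure, forall t, I01 t -> f' t = fstar t}].
Proof.
move=> J fstar.
have [_ [_ [_ _ _ _ [calpha _]]]] := HB.
have [_ w0 _] := Hw.
have alpha0 t : I01 t -> 0 <= alpha t.
  apply: (jump_ge0 HA HC HB) => s u Is Iu; first exact: autocovariance_sym Hr _ _ Is Iu.
  exact: autocovariance_diff_ge0 Heps0 Hr _ _ Is Iu.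
have aw0 t : I01 t -> 0 <= alpha t * w t by move=> It; rewrite mulr_ge0 ?alpha0 ?w0.
have densE := optimal_density_density calpha Hwc aw0 Haw.
have JE := design_criterion_optimal calpha Hwc aw0 Haw.
have infE := ereal_inf_design_criterion calpha Hwc aw0 Haw.
split => //.
- by rewrite /J /fstar JE infE.
- move=> awpos; split.
    by split => // t It; apply: optimal_density_gt0 => //; exact: awpos.
  by move=> f' Hf'; rewrite /J /fstar JE; exact: design_criterion_ge.
- move=> f' [pf' minf']; apply: design_criterion_min_unique => //.
  (* A minimizer bounds all values from below, so its value is at most the infimum [c^3]. *)
  apply/eqP; rewrite eq_le design_criterion_ge// andbT -infE.
  by apply: le_ereal_inf_tmp => _ [f1 hf1 <-]; exact: minf'.
Qed.
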